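(* For every prime power $q$ and every integer $m\geq 1$, $$\rho_2(1,m)=(q-1)q^{m-1}-q^{\lceil\frac{m}{2}\rceil-1}.$$
   Context: Let $q$ be a prime power and $\mathbb{F}_q$ the field with $q$ elements. $B_m^q=\mathbb{F}_q[X_1,\ldots,X_m]/(X_1^q-X_1,\ldots,X_m^q-X_m)$ is identified with the set of all functions $\mathbb{F}_q^m\to\mathbb{F}_q$. The degree $\deg(P)$ of $P\in B_m^q$ is the degree of its unique polynomial representative of degree at most $q-1$ in each variable. The weight of $P\in B_m^q$ is $|P|=\mathrm{Card}\{x\in\mathbb{F}_q^m : P(x)\neq 0\}$. For $r\ge 0$, the $r$th order generalized Reed-Muller code is $R_q(r,m)=\{P\in B_m^q : \deg(P)\leq r\}$ (which is all of $B_m^q$ when $r\ge m(q-1)$). The covering radius of $R_q(1,m)$ in $R_q(r,m)$ is $$\rho_r(1,m)=\max_{f\in R_q(r,m)}\ \min_{c\in R_q(1,m)}|f-c|.$$ *)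

(* Defs.v *)
From HB Require Import structures.
From mathcomp Require Import all_boot all_order all_algebra all_field.
From mathcomp Require Import mpoly.

Set Implicit Arguments.
Unset Strict Implicit.
Unset Printing Implicit Defensive.

Import Order.TTheory GRing.Theory Num.Theory.
Local Open Scope ring_scope.

(* The ring F[X_1, ..., X_m] / (X_i ^ q - X_i), where q = #|F|, is represented
   by the isomorphic ring of all functions F^m -> F.  The space F^m is the type
   'rV[F]_m of row vectors, and [x 0 : 'I_m -> F] gives the coordinates of x. *)
Notation "''B[' F ]_ m" := {ffun 'rV[F]_m -> F}
  (at level 8, m at level 2, format "''B[' F ]_ m") : type_scope.

Section ReedMuller.
Variables (F : finFieldType) (m : nat).
Implicit Types (f g : 'B[F]_m) (p : {mpoly F[m]}).

Definition mpoly_fun p : 'B[F]_m := [ffun x : 'rV[F]_m => p.@[x 0]].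

Definition reduced p : bool :=
  all (fun k : 'X_{1..m} => [forall i, (k i <= #|F|.-1)%N]) (msupp p).

(* The interpolation polynomial of f.  By [reduced_repr], [reprK] and
   [mpoly_fun_inj] below it is the unique reduced polynomial inducing f. *)
Definition repr f : {mpoly F[m]} :=
  \sum_(a : 'rV[F]_m)
    f a *: \prod_(i < m) (1 - ('X_i - (a 0 i)%:MP) ^+ #|F|.-1).

(* [msize] is the total degree plus one, and [msize 0 = 0]; hence the zero
   function has degree 0 here, instead of -oo. *)
Definition deg f : nat := (msize (repr f)).-1.

Definition weight f : nat := #|[set x | f x != 0]|.

Definition RM (r : nat) : {set 'B[F]_m} := [set f | (deg f <= r)%N].

(* The covering radius of C in D.  The default value #|F^m| of the minimum bounds
   every weight, so for nonempty C (such as a code RM r, by [RM_neq0]) the inner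
   operator is the true minimum (see [min_weight_le] and
   [min_weight_attained]). *)
Definition covering_radius (C D : {set 'B[F]_m}) : nat :=
  \max_(f in D) \big[minn/#|'rV[F]_m|]_(c in C) weight (f - c)%R.

Let bounded (d : 'I_m -> nat) p :=
  all (fun k : 'X_{1..m} => [forall i, (k i <= d i)%N]) (msupp p).

Let boundedP d p :
  reflect (forall k, k \in msupp p -> forall i, (k i <= d i)%N) (bounded d p).
Proof.
apply: (iffP allP) => [h k /h /forallP // | h k /h ?]; exact/forallP.
Qed.

Let bounded0 d : bounded d 0.
Proof. by apply/boundedP => k; rewrite msupp0. Qed.

Let boundedD d p q : bounded d p -> bounded d q -> bounded d (p + q).
Proof.
move=> /boundedP hp /boundedP hq; apply/boundedP => k /msuppD_le.
by rewrite mem_cat => /orP[/hp | /hq].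
Qed.

Let boundedN d p : bounded d p -> bounded d (- p).
Proof.
by move=> /boundedP hp; apply/boundedP => k; rewrite (perm_mem (msuppN p)) => /hp.
Qed.

Let boundedZ d c p : bounded d p -> bounded d (c *: p).
Proof. by move=> /boundedP hp; apply/boundedP => k /msuppZ_le /hp. Qed.

Let boundedM d e p q :
  bounded d p -> bounded e q -> bounded (fun i => d i + e i)%N (p * q).
Proof.
move=> /boundedP hp /boundedP hq; apply/boundedP => k /msuppM_le.
case/allpairsP => -[k1 k2] /= [k1p k2q ->] i.
by rewrite mnmDE leq_add ?hp ?hq.
Qed.

Let boundedC d c : bounded d c%:MP.
Proof.
apply/boundedP => k; rewrite msuppC; case: eqP => // _.
by rewrite inE => /eqP -> i; rewrite mnm0E.
Qed.

Let boundedW d e p : (forall i, d i <= e i)%N -> bounded d p -> bounded e p.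
Proof.
by move=> h /boundedP hp; apply/boundedP => k /hp kd i; apply: leq_trans (h i).
Qed.

Let bounded_exp d p n : bounded d p -> bounded (fun i => n * d i)%N (p ^+ n).
Proof.
move=> hp; elim: n => [|n IHn]; first by rewrite expr0; exact: boundedC.
by rewrite exprS; apply: boundedW (boundedM hp IHn) => i; rewrite mulSn.
Qed.

Let bounded_prod (d : 'I_m -> 'I_m -> nat) (P : 'I_m -> {mpoly F[m]}) r :
  (forall i, bounded (d i) (P i)) ->
  bounded (fun j => \sum_(i <- r) d i j)%N (\prod_(i <- r) P i).
Proof.
move=> h; elim: r => [|i r IHr]; first by rewrite big_nil; exact: boundedC.
rewrite big_cons; apply: boundedW (boundedM (h i) IHr) => j.
by rewrite big_cons.
Qed.

Lemma reduced_repr f : reduced (repr f).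
Proof.
rewrite /repr; elim/big_ind: _ => [|p q|a _]; first exact: bounded0.
  exact: boundedD.
apply: boundedZ.
pose d (i j : 'I_m) := (#|F|.-1 * (i == j))%N.
have h i : bounded (d i) (1 - ('X_i - (a 0 i)%:MP) ^+ #|F|.-1).
  apply: boundedD; first exact: boundedC.
  apply/boundedN/bounded_exp/boundedD; last exact/boundedN/boundedC.
  by apply/boundedP => k; rewrite msuppX inE => /eqP -> j; rewrite mnm1E.
apply: boundedW (bounded_prod (index_enum 'I_m) h) => j.
rewrite (bigD1 j) //= big1 ?addn0 /d ?eqxx ?muln1 // => i /negPf ->.
by rewrite muln0.
Qed.

Lemma reprK : cancel repr mpoly_fun.
Proof.
have expF (y : F) : y ^+ #|F|.-1 = (y != 0)%:R.
  have q1 : (1 < #|F|)%N := finNzRing_gt1 F.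
  case: eqP => [->|/eqP y0]; first by rewrite expr0n -subn1 subn_eq0 leqNgt q1.
  by apply: (mulfI y0); rewrite -exprS prednK ?expf_card ?mulr1 // ltnW.
move=> f; apply/ffunP => x; rewrite ffunE /repr raddf_sum /= (bigD1 x) //=.
rewrite [X in _ + X]big1 => [|a ax].
  rewrite addr0 mevalZ rmorph_prod /= big1 ?mulr1 // => i _.
  by rewrite mevalB meval1 rmorphXn /= mevalB mevalXU mevalC subrr expF eqxx subr0.
have [i xai]: exists i, x 0 i != a 0 i.
  apply/existsP; rewrite -negb_forall; apply: contra ax => /forallP h.
  by apply/eqP/rowP => i; rewrite (eqP (h i)).
rewrite mevalZ rmorph_prod /= (bigD1 i) //=.
rewrite mevalB meval1 rmorphXn /= mevalB mevalXU mevalC expF subr_eq0 xai.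
by rewrite subrr mul0r mulr0.
Qed.

Lemma mpoly_fun_inj : {in reduced &, injective mpoly_fun}.
Proof.
pose E := {ffun 'I_m -> 'I_#|F|}; pose C := {ffun E -> F}.
pose mon (e : E) : 'X_{1..m} := [multinom nat_of_ord (e i) | i < m].
pose coefs p : C := [ffun e => p@_(mon e)].
have coefs_inj : {in reduced &, injective coefs}.
  move=> p q /boundedP hp /boundedP hq /ffunP eqc; apply/mpolyP => k.
  have [/forallP kq | ] := boolP [forall i, (k i < #|F|)%N].
    have := eqc [ffun i => Ordinal (kq i)]; rewrite !ffunE.
    by suff -> : mon [ffun i => Ordinal (kq i)] = k by [];
      apply/mnmP => i; rewrite mnmE ffunE.
  rewrite negb_forall => /existsP[i ki].
  have q0 : (0 < #|F|)%N by apply: ltnW (finNzRing_gt1 F).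
  rewrite !memN_msupp_eq0 //.
    by apply/negP => /hq /(_ i); rewrite -ltnS prednK // (negPf ki).
  by apply/negP => /hp /(_ i); rewrite -ltnS prednK // (negPf ki).
have inj_cr : injective (coefs \o repr).
  move=> f g /= /coefs_inj eqfg.
  by apply: (can_inj reprK); apply: eqfg; exact: reduced_repr.
have [|h crK hK] := inj_card_bij inj_cr.
  by rewrite !card_ffun !card_ord card_mx mul1n.
have surj p : reduced p -> p = repr (h (coefs p)).
  move=> rp; apply: coefs_inj => //; first exact: reduced_repr.
  by have /= -> := hK (coefs p).
move=> p q /surj -> /surj ->; by rewrite !reprK => ->.
Qed.

Lemma mpoly_funK : {in reduced, cancel mpoly_fun repr}.
Proof.
by move=> p rp; apply: mpoly_fun_inj; rewrite ?reprK //; exact: reduced_repr.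
Qed.

Lemma RM0 r : 0 \in RM r.
Proof.
rewrite inE /deg /repr big1 ?msize0 // => a _.
by rewrite ffunE scale0r.
Qed.

Lemma RM_neq0 r : RM r != set0.
Proof.
apply/set0Pn; exists 0; rewrite inE /deg /repr big1 ?msize0 // => a _.
by rewrite ffunE scale0r.
Qed.

Lemma min_weight_le (C : {set 'B[F]_m}) f c : c \in C ->
  (\big[minn/#|'rV[F]_m|]_(c in C) weight (f - c)%R <= weight (f - c)%R)%N.
Proof.
move=> cC; elim: (index_enum _) (mem_index_enum c) => [|b r IHr] //=.
rewrite inE big_cons => /orP[/eqP <-|/IHr le_r]; first by rewrite cC geq_minl.
by case: ifP => // _; rewrite geq_min le_r orbT.
Qed.

Lemma min_weight_attained (C : {set 'B[F]_m}) f : C != set0 ->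
  exists2 c, c \in C &
    \big[minn/#|'rV[F]_m|]_(c in C) weight (f - c)%R = weight (f - c)%R.
Proof.
case/set0Pn => z zC; pose c0 := [arg min_(c < z in C) weight (f - c)%R]%N.
have [c0C min_c] : c0 \in C /\
    forall c, c \in C -> (weight (f - c0)%R <= weight (f - c)%R)%N.
  by rewrite /c0; case: arg_minnP.
exists c0 => //; apply/eqP; rewrite eqn_leq min_weight_le //=.
elim/big_ind: _ => [|x y hx hy|c /min_c //]; first exact: max_card.
by rewrite leq_min hx hy.
Qed.

End ReedMuller.

(* Main.v *)
Require Import Defs.
From mathcomp Require Import all_boot all_order all_algebra all_field.
From mathcomp Require Import mxabelem mpoly zify ring.
Import GRing.Theory.
Local Open Scope ring_scope.

Set Implicit Arguments.
Unset Strict Implicit.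
Unset Printing Implicit Defensive.

(** Write [q] for [#|F|].  A function of degree at most 2 is a quadratic form plus
    an affine function, so the distance from it to the code of affine functions is
    [q ^ m - N], where [N] is the largest number of points at which the form [Q]
    agrees with an affine function [c].  One has to show that the least possible
    value of [N], over all forms [Q], is [q ^ (m - 1) + q ^ (uphalf m - 1)].

    Both bounds rest on one count ([agreement_critical]).  Let [W] be a totally
    singular subspace ([Q = 0] on [W]).  On a coset [x + W] the function [Q - c] is
    affine, with linear part [w |-> B(x, w) - c_lin(w)], where [B] is the polar form
    of [Q].  Where this linear part is nonzero, [Q - c] takes all values equally
    often.  So only the critical set of the [x] with zero linear part can make the
    number of agreements differ from the average [q ^ (m - 1)].

    Every form agrees often with some [c] ([large_agreement]).  Take [W] of the
    largest possible dimension [k], and [c] with linear part vanishing on [W], so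
    that the critical set is the orthogonal [K] of [W].  Let [a] be the dimension of
    [K]; then [a + k >= m], and by maximality [Q] vanishes on [K] only in [W].
    If [a = k], take [c = 0], which agrees with [Q] on [W].  If [a = k + 1], make [c]
    agree with [Q] also at one point [z] of [K] outside [W], hence on [z + W].
    If [a >= k + 2], take [c] constant: [Q] has only [q ^ k] zeros on [K], so by
    averaging it takes some nonzero value often enough ([popular_value]).

    Some form agrees rarely with every [c] ([small_agreement]).  Take a sum of
    hyperbolic planes and of a form in one or two variables, [z ^ 2] or an
    anisotropic form.  With [W] the first half of the hyperbolic part, the critical
    set reduces the count to the small form ([hyperbolic_sum_agreement]), which
    agrees with an affine function at no more than 2 points ([unary_agreement]),
    respectively [q + 1] points ([anisotropic_agreement]).

    All arguments are uniform in the characteristic: a form is given by a matrix [A]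
    that need not be symmetric, and its polar form by [A + A^T]. *)

(** * Functions of degree at most two *)

Section LowDegree.
Variables (F : finFieldType) (m : nat).
Implicit Types (f g : 'B[F]_m) (x : 'rV[F]_m).

Definition quad n (A : 'M[F]_n) (x : 'rV[F]_n) : F := (x *m A *m x^T) 0 0.

Definition affine_fun (u : 'cV[F]_m) b : 'B[F]_m := [ffun x => (x *m u) 0 0 + b].

Definition quadratic_fun (A : 'M[F]_m) u b : 'B[F]_m :=
  [ffun x => quad A x] + affine_fun u b.

Let q_gt1 : (1 < #|F|)%N := finNzRing_gt1 F.

Lemma RM_sizeE r f : (f \in RM F m r) = (msize (Defs.repr f) <= r.+1)%N.
Proof. by rewrite inE /deg; case: (msize _). Qed.

Lemma RM_add r f g : f \in RM F m r -> g \in RM F m r -> f + g \in RM F m r.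
Proof.
rewrite !RM_sizeE => fr gr.
have -> : Defs.repr (f + g) = Defs.repr f + Defs.repr g.
  by rewrite /Defs.repr -big_split; apply: eq_bigr => a _; rewrite ffunE scalerDl.
by apply: leq_trans (msizeD_le _ _) _; rewrite geq_max fr gr.
Qed.

Lemma RM_scale r (a : F) f : f \in RM F m r -> [ffun x => a * f x] \in RM F m r.
Proof.
rewrite !RM_sizeE => fr.
have -> : Defs.repr [ffun x => a * f x] = a *: Defs.repr f.
  by rewrite /Defs.repr scaler_sumr; apply: eq_bigr => y _; rewrite ffunE scalerA.
exact: leq_trans (msizeZ_le _ _) fr.
Qed.

Lemma RM_sum r (I : Type) (s : seq I) (f : I -> 'B[F]_m) :
  (forall i, f i \in RM F m r) -> \sum_(i <- s) f i \in RM F m r.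
Proof.
move=> fr; elim/big_ind: _ => //; [exact: RM0|exact: RM_add].
Qed.

Lemma RM_mono r s f : (r <= s)%N -> f \in RM F m r -> f \in RM F m s.
Proof. by rewrite !inE => rs /leq_trans; apply. Qed.

(** Only for a reduced monomial can the degree of the induced function be read off:
    there the interpolation polynomial is the monomial itself. *)
Lemma RM_monomial (k : 'X_{1..m}) :
  (forall i, k i <= #|F|.-1)%N -> mpoly_fun 'X_[k] \in RM F m (mdeg k).
Proof.
move=> kq; have rk : 'X_[k] \in reduced (F := F) (m := m).
  by rewrite unfold_in; apply/allP => l; rewrite msuppX inE => /eqP ->; apply/forallP.
by rewrite RM_sizeE (mpoly_funK rk) msizeX.
Qed.

Lemma RM_const r b : [ffun=> b] \in RM F m r.
Proof.
have -> : [ffun=> b] = [ffun x => b * (mpoly_fun 'X_[0] : 'B[F]_m) x].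
  apply/ffunP => x; rewrite !ffunE mevalX big1 ?mulr1 // => i _.
  by rewrite mnm0E expr0.
apply/RM_scale/(RM_mono _ (RM_monomial _)) => [|i]; first by rewrite mdeg0.
by rewrite mnm0E.
Qed.

Lemma mpoly_fun_coord i : mpoly_fun 'X_i = [ffun x : 'rV[F]_m => x 0 i] :> 'B[F]_m.
Proof. by apply/ffunP => x; rewrite !ffunE mevalXU. Qed.

Lemma RM_coord i : [ffun x : 'rV[F]_m => x 0 i] \in RM F m 1.
Proof.
have := @RM_monomial U_(i); rewrite mdeg1 mpoly_fun_coord; apply=> j.
by rewrite mnm1E; case: eqP => // _; rewrite -ltnS prednK // ltnW.
Qed.

(** For [i = j] and [q = 2] the monomial [X_i ^ 2] is not reduced, but there it
    induces the same function as [X_i]. *)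
Lemma RM_coordM i j : [ffun x : 'rV[F]_m => x 0 i * x 0 j] \in RM F m 2.
Proof.
have [/andP[/eqP <- /eqP q2] | /negbTE ijq] := boolP ((i == j) && (#|F| == 2%N)).
  suff -> : [ffun x : 'rV[F]_m => x 0 i * x 0 i] = [ffun x : 'rV[F]_m => x 0 i].
    exact: RM_mono (RM_coord i).
  by apply/ffunP => x; rewrite !ffunE -expr2 -q2 expf_card.
have -> : [ffun x : 'rV[F]_m => x 0 i * x 0 j] =
    mpoly_fun 'X_[U_(i) + U_(j)] :> 'B[F]_m.
  by apply/ffunP => x; rewrite !ffunE mpolyXD mevalM !mevalXU.
have := @RM_monomial (U_(i) + U_(j))%MM; rewrite mdegD !mdeg1; apply=> l.
rewrite mnmDE !mnm1E.
rewrite -ltnS prednK ?(ltnW q_gt1) //.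
have [ij|ij] := eqVneq i j; last first.
  apply: leq_ltn_trans q_gt1.
  by have [<-|_] := eqVneq i l; [rewrite eq_sym (negPf ij)|case: (j == l)].
have q2 : (2 < #|F|)%N.
  by rewrite ltn_neqAle q_gt1 andbT eq_sym; move: ijq; rewrite ij eqxx /= => ->.
by apply: leq_ltn_trans q2; rewrite -ij; case: (i == l).
Qed.

Lemma affine_fun_RM u b : affine_fun u b \in RM F m 1.
Proof.
have -> : affine_fun u b =
    \sum_i [ffun x : 'rV[F]_m => u i 0 * [ffun x : 'rV[F]_m => x 0 i] x]
      + [ffun=> b].
  apply/ffunP => x; rewrite !ffunE sum_ffunE mxE; congr (_ + _).
  by apply: eq_bigr => i _; rewrite !ffunE mulrC.
by apply: RM_add (RM_const _ _); apply: RM_sum => i; exact/RM_scale/RM_coord.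
Qed.

Lemma quadratic_fun_RM A u b : quadratic_fun A u b \in RM F m 2.
Proof.
apply: RM_add; last exact: RM_mono (affine_fun_RM u b).
have -> : [ffun x => quad A x] =
    \sum_j \sum_i [ffun x : 'rV[F]_m =>
       A i j * [ffun x : 'rV[F]_m => x 0 i * x 0 j] x].
  apply/ffunP => x; rewrite !ffunE sum_ffunE /quad mxE; apply: eq_bigr => j _.
  rewrite sum_ffunE !mxE mulr_suml; apply: eq_bigr => i _.
  by rewrite !ffunE [RHS]mulrCA mulrA.
by apply: RM_sum => j; apply: RM_sum => i; exact/RM_scale/RM_coordM.
Qed.

(** The monomials are listed with their coefficients because the next lemmas build
    the affine or quadratic normal form by induction on this list. *)
Lemma RM_monomials r f : f \in RM F m r ->
  exists2 s : seq (F * 'X_{1..m}),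
    (forall ck, ck \in s -> mdeg ck.2 <= r)%N &
    forall x, f x = \sum_(ck <- s) ck.1 * \prod_i x 0 i ^+ ck.2 i.
Proof.
rewrite RM_sizeE => fr; exists [seq ((Defs.repr f)@_k, k) | k <- msupp (Defs.repr f)].
  by move=> _ /mapP[k /msize_mdeg_lt kr ->]; apply: leq_trans kr fr.
by move=> x; rewrite -[f in LHS]Defs.reprK ffunE mevalE [RHS]big_map.
Qed.

Lemma mdegS_split (k : 'X_{1..m}) r : (mdeg k <= r.+1)%N ->
  k = 0%MM \/ exists i, exists2 l, k = (U_(i) + l)%MM & (mdeg l <= r)%N.
Proof.
move=> kr; have [->|k0] := eqVneq k 0%MM; [by left|right].
have [i ki] : exists i, k i != 0%N.
  apply/existsP; rewrite -negb_forall; apply: contra k0 => /forallP k0.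
  by apply/eqP/mnmP => i; rewrite mnm0E (eqP (k0 i)).
have ek : k = (U_(i) + (k - U_(i)))%MM.
  apply/mnmP => j; rewrite mnmDE mnmBE mnm1E.
  by case: eqP => [<-|]; lia.
by exists i, (k - U_(i))%MM => //; move: kr; rewrite {1}ek mdegD mdeg1.
Qed.

Lemma prod_mnm0 x : \prod_i x 0 i ^+ (0%MM : 'X_{1..m}) i = 1.
Proof. by rewrite big1 // => i _; rewrite mnm0E expr0. Qed.

Lemma prod_mnmUD x i (l : 'X_{1..m}) :
  \prod_j x 0 j ^+ (U_(i) + l)%MM j = x 0 i * \prod_j x 0 j ^+ l j.
Proof.
rewrite (eq_bigr (fun j => x 0 j ^+ U_(i)%MM j * x 0 j ^+ l j)); last first.
  by move=> j _; rewrite mnmDE exprD.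
rewrite big_split /=; congr (_ * _).
rewrite (bigD1 i) //= big1 ?mulr1 => [|j /negPf ji]; first by rewrite mnm1E eqxx.
by rewrite mnm1E eq_sym ji expr0.
Qed.

Lemma monomial1P (k : 'X_{1..m}) : (mdeg k <= 1)%N ->
  exists u b, forall x, \prod_i x 0 i ^+ k i = affine_fun u b x.
Proof.
case/mdegS_split => [->|[i [l ->]]].
  by exists 0, 1 => x; rewrite prod_mnm0 !ffunE mulmx0 mxE add0r.
rewrite leqn0 mdeg_eq0 => /eqP ->; exists (delta_mx i 0), 0 => x.
by rewrite prod_mnmUD prod_mnm0 !ffunE mulr1 -colE mxE addr0.
Qed.

Lemma RM1P f : f \in RM F m 1 -> exists u b, f = affine_fun u b.
Proof.
case/RM_monomials => s sr fE.
suff [u [b h]] : exists u b, forall x,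
    \sum_(ck <- s) ck.1 * \prod_i x 0 i ^+ ck.2 i = affine_fun u b x.
  by exists u, b; apply/ffunP => x; rewrite fE h.
elim: s sr {fE} => [|[c k] s IHs] sr.
  by exists 0, 0 => x; rewrite big_nil ffunE mulmx0 mxE addr0.
have [|u [b h]] := IHs; first by move=> ck cks; apply: sr; rewrite inE cks orbT.
have [|u' [b' h']] := @monomial1P k; first by apply: sr (mem_head _ _).
exists (c *: u' + u), (c * b' + b) => x; rewrite big_cons h h' !ffunE.
by rewrite mulmxDr -scalemxAr !mxE /=; ring.
Qed.

Lemma quadD (A B : 'M_m) x : quad (A + B) x = quad A x + quad B x.
Proof. by rewrite /quad mulmxDr mulmxDl mxE. Qed.

Lemma quadZ c (A : 'M_m) x : quad (c *: A) x = c * quad A x.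
Proof. by rewrite /quad -scalemxAr -scalemxAl mxE. Qed.

Lemma monomial2P (k : 'X_{1..m}) : (mdeg k <= 2)%N ->
  exists A u b, forall x, \prod_i x 0 i ^+ k i = quadratic_fun A u b x.
Proof.
case/mdegS_split => [->|[i [l -> /monomial1P[u [b h]]]]].
  exists 0, 0, 1 => x; rewrite prod_mnm0 !ffunE /quad !mulmx0 mul0mx !mxE.
  by rewrite !add0r.
exists (delta_mx i 0 *m u^T), (b *: delta_mx i 0), 0 => x.
rewrite prod_mnmUD h !ffunE /quad mulmxA -colE -mulmxA -trmx_mul.
by rewrite -scalemxAr -colE !mxE big_ord1 !mxE; ring.
Qed.

Lemma RM2P f : f \in RM F m 2 -> exists A u b, f = quadratic_fun A u b.
Proof.
case/RM_monomials => s sr fE.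
suff [A [u [b h]]] : exists A u b, forall x,
    \sum_(ck <- s) ck.1 * \prod_i x 0 i ^+ ck.2 i = quadratic_fun A u b x.
  by exists A, u, b; apply/ffunP => x; rewrite fE h.
elim: s sr {fE} => [|[c k] s IHs] sr.
  exists 0, 0, 0 => x; rewrite big_nil !ffunE /quad !mulmx0 mul0mx !mxE.
  by rewrite !addr0.
have [|A [u [b h]]] := IHs.
  by move=> ck cks; apply: sr; rewrite inE cks orbT.
have [|A' [u' [b' h']]] := @monomial2P k; first by apply: sr (mem_head _ _).
exists (c *: A' + A), (c *: u' + u), (c * b' + b) => x.
rewrite big_cons h h' !ffunE quadD quadZ.
by rewrite mulmxDr -scalemxAr !mxE /=; ring.
Qed.

End LowDegree.

(** * Agreement of a quadratic form with affine functions *)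

Section Agreement.
Variables (F : finFieldType) (m : nat).
Implicit Types (A : 'M[F]_m) (x y : 'rV[F]_m) (u : 'cV[F]_m).

(** Moving [x] by [t *: s x] raises [g] by [t] and can be undone, since [s] does not
    change along the move; hence the level sets of [g] on [D] have the same size. *)
Lemma equidistributed_zeros (D : {set 'rV[F]_m}) (s : 'rV[F]_m -> 'rV[F]_m)
    (g : 'rV[F]_m -> F) :
  (forall x, x \in D -> forall t,
    [/\ x + t *: s x \in D, s (x + t *: s x) = s x & g (x + t *: s x) = g x + t]) ->
  (#|F| * #|[set x in D | g x == 0%R]| = #|D|)%N.
Proof.
move=> sD; pose level b := [set x in D | g x == b].
have level_le b c : (#|level b| <= #|level c|)%N.
  rewrite -(@card_in_imset _ _ (fun x => x + (c - b) *: s x)).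
    apply/subset_leq_card/subsetP => _ /imsetP[x + ->].
    rewrite !inE => /andP[/sD/(_ (c - b))[-> _ ->] /eqP ->].
    by rewrite addrC subrK eqxx.
  move=> x y; rewrite !inE => /andP[/sD/(_ (c - b))[_ sx _] _].
  case/andP=> /sD/(_ (c - b))[_ sy _] _ xy.
  by apply: (addIr ((c - b) *: s x)); rewrite {1}xy -sx xy sy.
rewrite -[RHS]sum1_card (partition_big g predT) //=.
rewrite (eq_bigr (fun=> #|level 0%R|)) => [|b _]; first by rewrite sum_nat_const.
by rewrite sum1dep_card; apply/eqP; rewrite eqn_leq !level_le.
Qed.

Lemma mx11D (M N : 'M[F]_1) : (M + N) 0 0 = M 0 0 + N 0 0.
Proof. by rewrite mxE. Qed.

Lemma mx11T (M : 'M[F]_1) : M^T 0 0 = M 0 0.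
Proof. by rewrite mxE. Qed.

Definition polar A x y : F := (x *m (A + A^T) *m y^T) 0 0.

Lemma quad_polarD A x y : quad A (x + y) = quad A x + quad A y + polar A x y.
Proof.
rewrite /quad /polar linearD /= !(mulmxDl, mulmxDr) !mx11D.
rewrite -[(x *m A^T *m y^T) 0 0]mx11T !trmx_mul !trmxK mulmxA; ring.
Qed.

Lemma quadZv A t x : quad A (t *: x) = t ^+ 2 * quad A x.
Proof.
by rewrite /quad linearZ /= -!scalemxAl -scalemxAr scalerA mxE expr2.
Qed.

Definition totally_singular r A (W : 'M[F]_(r, m)) :=
  [forall v : 'rV[F]_r, quad A (v *m W) == 0].

(** The orthogonal of the row space of [W] for the polar form. *)
Definition perp r A (W : 'M[F]_(r, m)) := kermx ((A + A^T) *m W^T).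

Lemma singular_quad r A (W : 'M[F]_(r, m)) x :
  totally_singular A W -> (x <= W)%MS -> quad A x = 0.
Proof. by move=> /forallP sW /submxP[v ->]; apply/eqP. Qed.

Lemma sub_perp r A (W : 'M[F]_(r, m)) x :
  (x <= perp A W)%MS = (x *m (A + A^T) *m W^T == 0).
Proof. by rewrite sub_kermx mulmxA. Qed.

Lemma polar_perp r A (W : 'M[F]_(r, m)) x y :
  (x <= perp A W)%MS -> (y <= W)%MS -> polar A x y = 0.
Proof.
rewrite sub_perp => /eqP xW /submxP[v ->].
by rewrite /polar trmx_mul mulmxA xW mul0mx mxE.
Qed.

(** The polar form of [Q] vanishes on [W] because it is [Q(x + y) - Q(x) - Q(y)];
    this is valid in characteristic 2 too. *)
Lemma singular_sub_perp r A (W : 'M[F]_(r, m)) :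
  totally_singular A W -> (W <= perp A W)%MS.
Proof.
move=> sW; rewrite sub_kermx; apply/eqP/matrixP => i j; rewrite mulmxA.
have e : polar A (row i W) (row j W) = 0.
  have := quad_polarD A (row i W) (row j W).
  by rewrite !(singular_quad sW) ?addmx_sub ?row_sub // !add0r.
rewrite [RHS]mxE -[RHS]e /polar -row_mul tr_row [LHS]mxE [RHS]mxE.
by apply: eq_bigr => k _; rewrite !mxE.
Qed.

(** A singular vector orthogonal to [W] could be added to [W]; so in a totally
    singular [W] of maximal rank it is already contained. *)
Lemma max_singular A : exists2 W : 'M[F]_m, totally_singular A W &
  forall x, (x <= perp A W)%MS -> quad A x = 0 -> (x <= W)%MS.
Proof.
have s0 : totally_singular A (0 : 'M_m).
  by apply/forallP => v; rewrite /quad mulmx0 !mul0mx mxE.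
pose W := [arg max_(W > (0 : 'M[F]_m)%R | totally_singular A W) \rank W]%N.
have [sW maxW] : totally_singular A W /\
    forall W' : 'M_m, totally_singular A W' -> (\rank W' <= \rank W)%N.
  by rewrite /W; case: arg_maxnP.
exists W => // x xW qx.
have sWx : totally_singular A (W + x)%MS.
  apply/forallP => v.
  have /sub_addsmxP[[a b] /= ->] : (v *m (W + x)%MS <= W + x)%MS by exact: submxMl.
  rewrite addrC [b]mx11_scalar mul_scalar_mx quad_polarD quadZv qx mulr0 add0r.
  rewrite (singular_quad sW) ?submxMl // add0r (polar_perp _ (submxMl _ _)) //.
  exact: scalemx_sub.
have [le_rk rk_eq] := mxrank_leqif_sup (addsmxSl W x).
have : (W + x <= W)%MS by rewrite -rk_eq eqn_leq le_rk maxW.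
by rewrite addsmx_sub => /andP[].
Qed.

Lemma card_submx n (M : 'M[F]_(n, m)) :
  #|[set x : 'rV[F]_m | (x <= M)%MS]| = (#|F| ^ \rank M)%N.
Proof. exact: card_rowg. Qed.

Lemma dual_vector n (x : 'rV[F]_n) : x != 0 -> exists v : 'cV[F]_n, (x *m v) 0 0 = 1.
Proof.
case/rV0Pn => i xi; exists ((x 0 i)^-1 *: delta_mx i 0).
by rewrite -scalemxAr -colE !mxE mulVf.
Qed.

Definition agreement A (u : 'cV[F]_m) b : {set 'rV[F]_m} :=
  [set x | quad A x == (x *m u) 0 0 + b].

(** The points [x] such that [quad A] minus an affine function of linear part [u] is
    constant on the coset [x + W], for totally singular [W]. *)
Definition critical r A (W : 'M[F]_(r, m)) u : {set 'rV[F]_m} :=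
  [set x : 'rV[F]_m | x *m (A + A^T) *m W^T == (W *m u)^T].

(** Off the critical set the linear part [psi x] of the difference on [x + W] is
    nonzero and depends only on the coset; a vector of [W] on which it takes the
    value 1 is a direction for [equidistributed_zeros]. *)
Lemma agreement_critical r A (W : 'M[F]_(r, m)) u b : totally_singular A W ->
  (#|F| * #|agreement A u b| + #|critical A W u| =
   #|F| ^ m + #|F| * #|agreement A u b :&: critical A W u|)%N.
Proof.
move=> sW; pose D := ~: critical A W u.
pose psi x : 'rV[F]_r := x *m (A + A^T) *m W^T - (W *m u)^T.
have psi0 x : (x \in D) = (psi x != 0) by rewrite !inE subr_eq0.
pose dual (p : 'rV[F]_r) : 'cV[F]_r := odflt 0 [pick v | (p *m v) 0 0 == 1].
have dualP p : p != 0 -> (p *m dual p) 0 0 = 1.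
  move=> /dual_vector[v pv]; rewrite /dual; case: pickP => [w /eqP //|/(_ v)].
  by rewrite pv eqxx.
pose s x := (dual (psi x))^T *m W.
have psis x t : psi (x + t *: s x) = psi x.
  have /sub_kermxP := singular_sub_perp sW; rewrite mulmxA => WW.
  rewrite /psi !mulmxDl -!scalemxAl -!mulmxA [W *m _]mulmxA.
  by rewrite WW mulmx0 scaler0 addr0.
pose g x := quad A x - ((x *m u) 0 0 + b).
have off : (#|F| * #|[set x in D | g x == 0%R]| = #|D|)%N.
  apply: (@equidistributed_zeros D s) => x xD t.
  have ss : s (x + t *: s x) = s x by rewrite /s psis.
  split=> //; first by rewrite psi0 psis -psi0.
  have -> : g (x + t *: s x) = g x + t * (psi x *m dual (psi x)) 0 0.
    rewrite /g quad_polarD quadZv [quad A (s x)](singular_quad sW (submxMl _ _)).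
    have -> : polar A x (t *: s x) =
        t * (x *m (A + A^T) *m W^T *m dual (psi x)) 0 0.
      by rewrite /polar linearZ /= -scalemxAr trmx_mul trmxK mulmxA mxE.
    have entryE (P Q : 'M[F]_1) c : (P + c *: Q) 0 0 = P 0 0 + c * Q 0 0.
      by rewrite !mxE.
    have -> : psi x *m dual (psi x) = x *m (A + A^T) *m W^T *m dual (psi x) +
        (-1) *: ((W *m u)^T *m dual (psi x)) by rewrite scaleN1r -mulmxBl.
    have -> : (x + t *: s x) *m u = x *m u + t *: ((dual (psi x))^T *m (W *m u)).
      by rewrite mulmxDl -scalemxAl mulmxA.
    rewrite !entryE.
    rewrite -[(_ *m (W *m u)) 0 0]mx11T [(_ *m (W *m u))^T]trmx_mul trmxK; ring.
  by rewrite dualP ?mulr1 // -psi0.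
rewrite -(cardsID (critical A W u) (agreement A u b)) mulnDr -addnA addnC.
congr (_ + _)%N.
have -> : (#|F| ^ m)%N = (#|D| + #|critical A W u|)%N.
  by rewrite addnC cardsC card_mx mul1n.
rewrite -off; congr (_ * _ + _)%N; apply: eq_card => x.
by rewrite !inE /g subr_eq0.
Qed.

End Agreement.

(** * Every quadratic form agrees often with some affine function *)

Section LargeAgreement.
Variables (F : finFieldType) (m : nat).
Implicit Types (A : 'M[F]_m) (x y : 'rV[F]_m).

Let q_gt1 : (1 < #|F|)%N := finNzRing_gt1 F.

(** On the orthogonal, of dimension [a], at least [q ^ a - q ^ (a - 2)] points have
    a nonzero value.  There are [q - 1] nonzero values, and the average
    [(q ^ a - q ^ (a - 2)) / (q - 1)] is [q ^ (a - 1) + q ^ (a - 2)]. *)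
Lemma popular_value A (W : 'M[F]_m) :
  (forall x, (x <= perp A W)%MS -> quad A x = 0 -> (x <= W)%MS) ->
  (\rank W + 2 <= \rank (perp A W))%N ->
  exists b, (#|F| ^ (\rank (perp A W) - 1) + #|F| ^ (\rank (perp A W) - 2) <=
    #|[set x : 'rV[F]_m | (x <= perp A W)%MS & quad A x == b]|)%N.
Proof.
set K := perp A W => maxW le_rk.
pose N b := #|[set x : 'rV[F]_m | (x <= K)%MS & quad A x == b]|.
set M := (_ + _)%N; have [/existsP[b] |] := boolP [exists b, (M <= N b)%N].
  by exists b.
rewrite negb_exists => /forallP small; exfalso.
have sumN : (\sum_b N b = #|F| ^ \rank K)%N.
  rewrite -card_submx -sum1_card (partition_big (quad A) predT) //=.
  apply: eq_bigr => b _; rewrite sum1dep_card.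
  by apply: eq_card => x; rewrite !inE.
have N0 : (N 0%R <= #|F| ^ \rank W)%N.
  rewrite -card_submx; apply/subset_leq_card/subsetP => x.
  by rewrite !inE => /andP[xK /eqP/(maxW _ xK)].
have N1 : (\sum_(b | b != 0%R) N b <= #|F|.-1 * M.-1)%N.
  rewrite -(cardC1 (0%R : F)) -sum_nat_const; apply: leq_sum => b _.
  by have := small b; rewrite -ltnNge; lia.
move: sumN; rewrite (bigD1 (0%R : F)) //= => sumN.
have [c eK] : exists c, \rank K = c.+2 by exists (\rank K - 2)%N; lia.
have leW : (#|F| ^ \rank W <= #|F| ^ c)%N by rewrite leq_pexp2l ?(ltnW q_gt1) //; lia.
have [r eq] : exists r, #|F| = r.+2 by exists (#|F| - 2)%N; lia.
have P0 : (0 < #|F| ^ c)%N by rewrite expn_gt0 (ltnW q_gt1).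
move: N0 N1 sumN leW P0; rewrite /M eK subn1 subn2 /= !expnS eq.
move: (_ ^ c)%N (_ ^ \rank W)%N (N 0%R) (\sum_(_ | _) _)%N => P Q x y.
nia.
Qed.

(** The cases [a = k], [a = k + 1] and [a >= k + 2] for the dimensions [k] of a
    maximal totally singular subspace [W] and [a] of its orthogonal [K].  As
    [m <= k + a], the exponent [uphalf m] is at most [k], [k + 1] and [a - 1]
    respectively. *)
Lemma large_agreement A : exists u b,
  (#|F| ^ m + #|F| ^ uphalf m <= #|F| * #|agreement A u b|)%N.
Proof.
have [W sW maxW] := max_singular A; set K := perp A W in maxW *.
have leWK : (\rank W <= \rank K)%N by rewrite mxrankS ?singular_sub_perp.
have lemWK : (m <= \rank W + \rank K)%N.
  have := mxrankM_maxr (A + A^T) W^T; rewrite mxrank_tr.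
  have -> : \rank K = (m - \rank ((A + A^T) *m W^T))%N by exact: mxrank_ker.
  by move=> le_rk; rewrite -leq_subLR leq_sub2l.
(* The linear part [u] vanishes on [W], so the critical set is [K]. *)
suff [u [b [Wu on]]] : exists u b, W *m u = 0 /\ (#|F| ^ \rank K + #|F| ^ uphalf m <=
    #|F| * #|[set x : 'rV[F]_m in agreement A u b | (x <= K)%MS]|)%N.
  exists u, b; have := agreement_critical u b sW.
  have -> : critical A W u = [set x : 'rV[F]_m | (x <= K)%MS].
    by apply/setP => x; rewrite !inE sub_perp Wu trmx0.
  rewrite card_submx -setIdE => e.
  by rewrite -(leq_add2r (#|F| ^ \rank K)) e -addnA leq_add2l addnC.
have expq i j : (i <= j)%N -> (#|F| ^ i <= #|F| ^ j)%N.
  by rewrite leq_exp2l.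
have [n_ge2|n_lt2] := leqP (\rank W + 2) (\rank K).
  have [b] := popular_value maxW n_ge2; rewrite -/K => bP.
  exists 0, b; split; first by rewrite mulmx0.
  have -> : [set x : 'rV[F]_m in agreement A 0 b | (x <= K)%MS] =
            [set x : 'rV[F]_m | (x <= K)%MS & quad A x == b].
    by apply/setP => x; rewrite !inE mulmx0 mxE add0r andbC.
  apply: leq_trans (leq_mul (leqnn _) bP).
  by rewrite mulnDr -!expnS leq_add ?expq //; lia.
have [eWK|neWK] := eqVneq (\rank W) (\rank K).
  exists 0, 0; split; first by rewrite mulmx0.
  have leS : (#|F| ^ \rank K <=
      #|[set x : 'rV[F]_m in agreement A 0 0 | (x <= K)%MS]|)%N.
    rewrite -eWK -card_submx; apply/subset_leq_card/subsetP => x.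
    rewrite !inE mulmx0 mxE addr0 => xW.
    by rewrite (singular_quad sW xW) eqxx (submx_trans xW) ?singular_sub_perp.
  apply: leq_trans (leq_mul q_gt1 leS).
  by rewrite mul2n -addnn leq_add2l expq //; lia.
have eK : (\rank K = \rank W + 1)%N by lia.
have /row_subPn[i zW] : ~~ (K <= W)%MS.
  by apply/negP => /mxrankS; lia.
(* The columns of [cokermx W] are linear forms vanishing on [W]; some combination
   of them takes the value [quad A z] at [z]. *)
set z := row i K in zW; have zK : (z <= K)%MS by exact: row_sub.
have {zW} zC : z *m cokermx W != 0 by rewrite -submxE.
have [v zv] := dual_vector zC.
pose u := quad A z *: (cokermx W *m v).
have Wu : W *m u = 0 by rewrite -scalemxAr mulmxA mulmx_coker mul0mx scaler0.
have zu : (z *m u) 0 0 = quad A z.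
  by rewrite -scalemxAr mulmxA mxE zv mulr1.
have xu x : (x <= W)%MS -> x *m u = 0.
  by case/submxP => a ->; rewrite -mulmxA Wu mulmx0.
exists u, 0; split=> //; set S := [set x in _ | _].
pose T : {set 'rV[F]_m} := [set x | (x <= W)%MS].
have subS : T :|: [set z + x | x in T] \subset S.
  apply/subsetP => x; rewrite !inE => /orP[xW|/imsetP[y + ->]].
    rewrite (singular_quad sW xW) xu // mxE addr0 eqxx /=.
    exact: submx_trans xW (singular_sub_perp sW).
  rewrite inE => yW; have yK := submx_trans yW (singular_sub_perp sW).
  rewrite quad_polarD (singular_quad sW yW) (polar_perp zK yW) mulmxDl (xu y) //.
  by rewrite !addr0 zu eqxx addmx_sub.
have disjT : [disjoint T & [set z + x | x in T]].
  apply/pred0Pn => -[x /andP[/=]]; rewrite inE => xW /imsetP[y].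
  rewrite inE => yW exy; case/negP: zC; rewrite -submxE.
  by rewrite -[z](addrK y) -exy addmx_sub ?eqmx_opp.
have := subset_leq_card subS.
rewrite cardsU (disjoint_setI0 disjT) cards0 subn0 card_imset; last exact: addrI.
rewrite card_submx => leS.
apply: leq_trans (leq_mul (leqnn _) leS).
by rewrite mulnDr -expnS eK addn1 leq_add2l expq //; lia.
Qed.

End LargeAgreement.

(** * Quadratic forms that agree rarely with every affine function *)

Section SmallAgreement.
Variable F : finFieldType.

(** The quadratic form [a b^T + quad B z] in the variables [(a, b, z)]. *)
Definition hyperbolic_sum k n (B : 'M[F]_n) : 'M[F]_(k + (k + n)) :=
  block_mx 0 (row_mx 1%:M 0) 0 (block_mx 0 0 0 B).

Lemma quad_hyperbolic_sum k n (B : 'M[F]_n) (a b : 'rV[F]_k) (z : 'rV[F]_n) :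
  quad (hyperbolic_sum k B) (row_mx a (row_mx b z)) = (a *m b^T) 0 0 + quad B z.
Proof.
rewrite /quad /hyperbolic_sum mul_row_block !mulmx0 addr0 mul_mx_row mulmx1 mulmx0.
rewrite mul_row_block !mulmx0 !add0r add_row_mx addr0 add0r !tr_row_mx !mul_row_col.
by rewrite mul0mx add0r [LHS]mxE.
Qed.

(** For [W] the space of the vectors [(a, 0, 0)], the critical set consists of the
    [(a, b, z)] with [b] equal to the first block of the linear part [u].  There [a]
    cancels from the difference, which leaves [quad B z] against an affine function
    of [z]. *)
Lemma hyperbolic_sum_agreement k n (B : 'M[F]_n) h :
  (forall u b, (#|agreement B u b| <= h)%N) ->
  forall u b, (#|F| * #|agreement (hyperbolic_sum k B) u b| + #|F| ^ (k + n) <=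
    #|F| ^ (k + (k + n)) + #|F| * (#|F| ^ k * h))%N.
Proof.
move=> Bh u b; pose A := hyperbolic_sum k B.
pose W : 'M[F]_(k, k + (k + n)) := row_mx 1%:M 0.
have sW : totally_singular A W.
  apply/forallP => v; rewrite mul_mx_row mulmx1 mulmx0 -[0]row_mx0.
  by rewrite quad_hyperbolic_sum /quad trmx0 !mul0mx mulmx0 !mxE addr0.
pose u1 := usubmx u; pose u2 := usubmx (dsubmx u); pose u3 := dsubmx (dsubmx u).
have Eu : u = col_mx u1 (col_mx u2 u3) by rewrite !vsubmxK.
pose point (az : 'rV[F]_k * 'rV[F]_n) := row_mx az.1 (row_mx u1^T az.2).
have point_inj : injective point.
  by move=> [a z] [a' z'] /eq_row_mx[/= -> /eq_row_mx[_ ->]].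
have critE : critical A W u = [set point az | az in setT].
  apply/setP => x; rewrite -[x]hsubmxK -[rsubmx x]hsubmxK.
  set a := lsubmx x; set y := lsubmx _; set z := rsubmx _.
  have -> : (row_mx a (row_mx y z) \in critical A W u) = (y == u1^T).
    rewrite inE Eu mul_row_col mul1mx mul0mx addr0 /A /hyperbolic_sum.
    rewrite tr_block_mx tr_block_mx !trmx0 tr_row_mx trmx0 trmx1.
    rewrite tr_row_mx trmx1 trmx0 mulmxDr !mul_row_block !mulmx0 !addr0 !add0r.
    rewrite mul_mx_row mulmx1 mulmx0 mul_row_col mulmx1 mulmx0 addr0 add_row_mx.
    by rewrite mul_row_col mulmx0 mulmx1 addr0 add0r.
  apply/eqP/imsetP => [->|[[a' z'] _ /eq_row_mx[_ /eq_row_mx[]]] //].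
  by exists (a, z).
have := agreement_critical u b sW; rewrite critE card_imset // cardsT card_prod.
rewrite !card_mx !mul1n -expnD => ->.
rewrite leq_add2l leq_mul2l; apply/orP; right.
pose b' := (u1^T *m u2) 0 0 + b.
pose P := setX [set: 'rV[F]_k] (agreement B u3 b').
apply: leq_trans (_ : #|P| <= _)%N; last first.
  by rewrite cardsX cardsT card_mx mul1n leq_mul2l Bh orbT.
rewrite -(card_imset _ point_inj); apply/subset_leq_card/subsetP => x.
case/setIP => xz /imsetP[[a z] _ ex]; rewrite ex imset_f // inE in_setT /=.
move: xz; rewrite ex !inE quad_hyperbolic_sum Eu !mul_row_col trmxK.
rewrite !mx11D /b' -!addrA => /eqP/addrI ->.
by apply/eqP; ring.
Qed.

Lemma quad_delta n (i j : 'I_n) (x : 'rV[F]_n) : quad (delta_mx i j) x = x 0 i * x 0 j.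
Proof.
rewrite /quad -(mul_delta_mx (0 : 'I_1)) mulmxA -colE -mulmxA -rowE mxE big_ord1.
by rewrite !mxE.
Qed.

(** A quadratic equation with root [x0] has only [u - x0] as another root, by Vieta. *)
Lemma unary_agreement (u : 'cV[F]_1) b : (#|agreement 1%:M u b| <= 2)%N.
Proof.
have [->|[x0 x0z]] := set_0Vmem (agreement 1%:M u b); first by rewrite cards0.
have zE x : (x \in agreement 1%:M u b) = (x 0 0 ^+ 2 == x 0 0 * u 0 0 + b).
  by rewrite inE /quad mulmx1 !mxE !big_ord1 mxE expr2.
suff /subset_leq_card/leq_trans : agreement 1%:M u b \subset [set x0; u^T - x0].
  by apply; rewrite cards2; case: (_ == _).
apply/subsetP => x; rewrite zE !inE => /eqP xz; move: x0z; rewrite zE => /eqP x0z.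
have /eqP : (x 0 0 - x0 0 0) * (x 0 0 + x0 0 0 - u 0 0) = 0.
  have -> : (x 0 0 - x0 0 0) * (x 0 0 + x0 0 0 - u 0 0) =
    x 0 0 ^+ 2 - x 0 0 * u 0 0 - (x0 0 0 ^+ 2 - x0 0 0 * u 0 0) by ring.
  by rewrite xz x0z; ring.
have rV1P (y z : 'rV[F]_1) : y 0 0 = z 0 0 -> y = z.
  by move=> yz; apply/rowP => i; rewrite ord1.
rewrite mulf_eq0 !subr_eq0 => /orP[] /eqP e; apply/orP; [left|right]; apply/eqP.
  exact: rV1P.
by apply: rV1P; rewrite !mxE -e addrK.
Qed.

(** Representatives of the [q + 1] points of the projective line. *)
Definition direction (o : option F) : 'rV[F]_2 :=
  if o is Some t then t *: delta_mx 0 0 + delta_mx 0 1 else delta_mx 0 0.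

Lemma directionE o : direction o 0 0 = odflt 1 o /\ direction o 0 1 = (o != None)%:R.
Proof. by case: o => [t|]; rewrite !mxE /= ?mulr1 ?mulr0 ?addr0 ?add0r. Qed.

Lemma rV2P (x y : 'rV[F]_2) : x 0 0 = y 0 0 -> x 0 1 = y 0 1 -> x = y.
Proof.
move=> e0 e1; apply/rowP => i; have [->|->] // : i = 0 \/ i = 1.
by case: i => -[|[|//]] lti; [left|right]; apply/val_inj.
Qed.

Lemma directionP (d : 'rV[F]_2) : d != 0 -> exists o t, t != 0 /\ d = t *: direction o.
Proof.
move=> d0; have [d1|d1] := eqVneq (d 0 1) 0.
  exists None, (d 0 0); split.
    by apply: contra d0 => /eqP d00; apply/eqP/rV2P; rewrite ?d00 ?d1 mxE.
  by apply: rV2P; rewrite !mxE /= ?d1; ring.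
exists (Some (d 0 0 / d 0 1)), (d 0 1); split=> //.
by apply: rV2P; rewrite !mxE /=; field.
Qed.

Lemma direction_neq0 o : direction o != 0.
Proof.
apply/eqP => d0; have [] := directionE o; rewrite d0 !mxE; case: o {d0} => [t|] /=.
  by move=> _ /esym/eqP; rewrite oner_eq0.
by move=> /esym/eqP; rewrite oner_eq0.
Qed.

Lemma direction_ker (c : 'cV[F]_2) : exists o, (direction o *m c) 0 0 = 0.
Proof.
have E o : (direction o *m c) 0 0 = odflt 1 o * c 0 0 + (o != None)%:R * c 1 0.
  have [e0 e1] := directionE o; rewrite mxE big_ord_recl big_ord1 e0.
  by rewrite (_ : lift ord0 ord0 = 1) ?e1 //; apply/val_inj.
have [c0|c0] := eqVneq (c 0 0) 0; first by exists None; rewrite E c0 /=; ring.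
by exists (Some (- c 1 0 / c 0 0)); rewrite E /= divfK // mul1r addNr.
Qed.

(** If the conic contains [x0], it is the set of [x0 + d] with [quad A d + l d = 0],
    [l] linear.  On the line through [x0] of direction [v] this leaves [d = 0] and
    [d = t *: v] with [t = - l v / quad A v], as [quad A v != 0].  The point [x0]
    itself is not an extra one: it is obtained, with [t = 0], from a direction in
    the kernel of [l].  So the [q + 1] directions parametrize the conic. *)
Lemma anisotropic_agreement (A : 'M[F]_2) : (forall x, quad A x = 0 -> x = 0) ->
  forall u b, (#|agreement A u b| <= #|F|.+1)%N.
Proof.
move=> anis u b; have [->|[x0 x0z]] := set_0Vmem (agreement A u b).
  by rewrite cards0.
pose l (d : 'rV[F]_2) := polar A x0 d - (d *m u) 0 0.
have lE d : l d = (d *m ((x0 *m (A + A^T))^T - u)) 0 0.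
  have entryB (M N : 'M[F]_1) : (M - N) 0 0 = M 0 0 - N 0 0 by rewrite !mxE.
  by rewrite /l /polar -mx11T trmx_mul trmxK mulmxBr entryB.
have lZ t d : l (t *: d) = t * l d by rewrite !lE -scalemxAl mxE.
pose pt o := x0 - (l (direction o) / quad A (direction o)) *: direction o.
rewrite -card_option -(cardsT (option F)).
apply: leq_trans (leq_imset_card pt _); apply/subset_leq_card/subsetP => x.
have -> : x = x0 + (x - x0) by rewrite addrC subrK.
set d := x - x0; move: x0z; rewrite !inE => /eqP x0z.
rewrite quad_polarD x0z mulmxDl mx11D -subr_eq0 => /eqP xz.
have {xz} dl : quad A d + l d = 0 by rewrite -xz /l; ring.
have [d0|d0] := eqVneq d 0.
  have [o lo] := direction_ker ((x0 *m (A + A^T))^T - u).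
  by apply/imsetP; exists o => //; rewrite d0 /pt lE lo mul0r scale0r subr0 addr0.
have [o [t [t0 dE]]] := directionP d0; apply/imsetP; exists o => //.
rewrite dE /pt; congr (_ + _); rewrite -scaleNr; congr (_ *: _).
have qo : quad A (direction o) != 0.
  by apply: contra (direction_neq0 o) => /eqP/anis ->.
apply: (mulfI qo); rewrite mulrN mulrCA divff // mulr1.
apply: (mulfI t0); apply/eqP; rewrite mulrN -addr_eq0 -lZ -dE -dl {2}dE quadZv.
by apply/eqP; ring.
Qed.

(** The map [z |-> z ^ 2 + z] identifies 0 and -1, so it is not onto; a value [- s]
    that it misses gives the anisotropic form [x ^ 2 + x y + s y ^ 2]. *)
Lemma anisotropic_binary : exists A : 'M[F]_2, forall x, quad A x = 0 -> x = 0.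
Proof.
have [s sP] : exists s, forall z : F, z ^+ 2 + z + s != 0.
  pose im := [set z ^+ 2 + z | z in [set: F]].
  have : im != [set: F].
    apply/eqP => imT; have : #|im| == #|[set: F]| by rewrite imT.
    move=> /imset_injP/(_ 0 (-1)); rewrite !in_setT => /(_ isT isT).
    have -> : (0 : F) ^+ 2 + 0 = (-1) ^+ 2 + -1 by ring.
    by move=> /(_ erefl)/eqP; rewrite eq_sym oppr_eq0 oner_eq0.
  rewrite -subTset => /subsetPn[y _ yim]; exists (- y) => z.
  by rewrite subr_eq0; apply: contra yim => /eqP <-; apply/imsetP; exists z.
exists (delta_mx 0 0 + delta_mx 0 1 + s *: delta_mx 1 1) => x.
rewrite !quadD quadZ !quad_delta => qx.
have [x1|x1] := eqVneq (x 0 1) 0.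
  apply: rV2P; rewrite !mxE //; move: qx; rewrite x1 !mulr0 !addr0 => /eqP.
  by rewrite mulf_eq0 orbb => /eqP.
case/eqP: (sP (x 0 0 / x 0 1)).
apply: (mulfI (expf_neq0 2 x1)); rewrite mulr0 -qx; field.
by [].
Qed.

Lemma small_agreement m : (0 < m)%N -> exists A : 'M[F]_m, forall u b,
  (#|F| * #|agreement A u b| <= #|F| ^ m + #|F| ^ uphalf m)%N.
Proof.
move=> m_gt0; have [odd_m|even_m] := boolP (odd m).
  have -> : m = (m./2 + (m./2 + 1))%N by lia.
  move: m./2 => k {m m_gt0 odd_m}; exists (hyperbolic_sum k 1%:M) => u b.
  have := hyperbolic_sum_agreement unary_agreement u b.
  have -> : uphalf (k + (k + 1)) = k.+1 by lia.
  move: #|agreement _ _ _| (#|F| ^ (k + (k + 1)))%N => Z M.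
  by rewrite addn1 mulnA -expnS muln2 -addnn addnA leq_add2r.
have -> : m = (m./2.-1 + (m./2.-1 + 2))%N by lia.
move: m./2.-1 => k {m m_gt0 even_m}; have [A anis] := anisotropic_binary.
exists (hyperbolic_sum k A) => u b.
have := hyperbolic_sum_agreement (anisotropic_agreement anis) u b.
have -> : uphalf (k + (k + 2)) = k.+1 by lia.
move: #|agreement _ _ _| (#|F| ^ (k + (k + 2)))%N => Z M.
rewrite addn2 mulnA -expnS mulnS [(_ ^ _ * _)%N]mulnC -expnS.
by rewrite addnA leq_add2r.
Qed.

End SmallAgreement.

(** * The covering radius *)

Section Radius.
Variables (F : finFieldType) (m : nat).

Lemma weight_quadratic_sub (A : 'M[F]_m) (u0 u : 'cV[F]_m) b0 b :
  (weight (quadratic_fun A u0 b0 - affine_fun u b)%R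
     + #|agreement A (u - u0)%R (b - b0)%R| = #|F| ^ m)%N.
Proof.
rewrite -[m in RHS]mul1n -card_mx -(cardsC (agreement A (u - u0) (b - b0))) addnC.
congr (_ + _)%N; apply: eq_card => x; rewrite !inE !ffunE mulmxBr -[in RHS]subr_eq0.
rewrite [((_ - _ : 'M_1) 0 0)]mxE [((- _ : 'M_1) 0 0)]mxE.
by congr (_ != 0); ring.
Qed.

Lemma covering_radius_RM12 : (0 < m)%N ->
  (covering_radius (RM F m 1) (RM F m 2) + (#|F| ^ m.-1 + #|F| ^ (uphalf m).-1)
   = #|F| ^ m)%N.
Proof.
move=> m_gt0; set R := covering_radius _ _; set e := (#|F| ^ m.-1 + _)%N.
have q0 : (0 < #|F|)%N := ltnW (finNzRing_gt1 F).
have qe : (#|F| ^ m + #|F| ^ uphalf m = #|F| * e)%N.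
  by rewrite /e mulnDr -!expnS !prednK //; case: (m) m_gt0.
apply/eqP; rewrite eqn_leq; apply/andP; split.
  have far_le (A : 'M[F]_m) u0 b0 : exists u b,
      (weight (quadratic_fun A u0 b0 - affine_fun u b)%R + e <= #|F| ^ m)%N.
    have [u [b]] := large_agreement A. rewrite qe leq_pmul2l // => ub.
    exists (u + u0), (b + b0).
    by rewrite -(weight_quadratic_sub A u0 (u + u0) b0 (b + b0)) !addrK leq_add2l.
  have e_le : (e <= #|F| ^ m)%N.
    by have [u [b]] := far_le 0 0 0; apply: leq_trans; exact: leq_addl.
  rewrite addnC -leq_subRL //; apply/bigmax_leqP => f /RM2P[A [u0 [b0 ->]]].
  have [u [b ub]] := far_le A u0 b0.
  apply: leq_trans (min_weight_le _ (affine_fun_RM u b)) _.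
  by rewrite leq_subRL // addnC.
have [A few] := small_agreement F m_gt0.
have [c /RM1P[u [b ->]] minE] :=
  min_weight_attained (quadratic_fun A 0 0) (RM_neq0 F m 1).
have le_R : (weight (quadratic_fun A 0 0 - affine_fun u b)%R <= R)%N.
  by rewrite -minE; exact: (bigmax_sup _ (quadratic_fun_RM A 0 0)).
rewrite -(weight_quadratic_sub A 0 u 0 b) !subr0 leq_add //.
by have := few u b; rewrite qe leq_pmul2l.
Qed.
End Radius.

Theorem theorem2 (q : nat) (F : finFieldType) (m : nat)
  (card_F : #|F| = q) (m_ge1 : (1 <= m)%N) :
  (covering_radius (RM F m 1) (RM F m 2))%:Z
    = (q%:Z - 1) * q%:Z ^+ (m - 1) - q%:Z ^+ (uphalf m - 1).
Proof.
have := covering_radius_RM12 F m_ge1; rewrite card_F !subn1.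
set R := covering_radius _ _ => RE.
have -> : R%:Z = q%:Z ^+ m - (q%:Z ^+ m.-1 + q%:Z ^+ (uphalf m).-1).
  have PoszX k : q%:Z ^+ k = (q ^ k)%N by rewrite -natrXE -!rmorphXn.
  by rewrite !PoszX; lia.
rewrite -{1}(prednK m_ge1) exprS; ring.
Qed.
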